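(* Let $X$ be a regular curve and $f:X\to X$ a homeomorphism. If $X\setminus\Omega(f)\neq\emptyset$, then $h_{top}(2^f)=+\infty$; otherwise $h_{top}(2^f)=0$. In particular $h_{top}(2^f)\in\{0,+\infty\}$.
   Context: A continuum is a non-empty compact connected metric space. A continuum $X$ is a regular curve if for every $\epsilon>0$ every point has an open neighborhood of diameter less than $\epsilon$ with finite boundary. A point $x\in X$ is wandering for $f$ if it has a neighborhood $U$ with $f^{-n}(U)\cap U=\emptyset$ for all $n\ge 1$; $\Omega(f)$ is the set of points that are not wandering. $2^X$ is the set of all non-empty compact subsets of $X$ with the Hausdorff metric, and $2^f:2^X\to 2^X$, $A\mapsto f(A)$. $h_{top}$ is the usual (Bowen–Dinaburg) topological entropy. *)

(* Defs.v *)
From HB Require Import structures.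
From mathcomp Require Import all_boot all_order all_algebra.
From mathcomp Require Import all_classical all_reals all_analysis.

Set Implicit Arguments.
Unset Strict Implicit.
Unset Printing Implicit Defensive.

Import Order.TTheory GRing.Theory Num.Theory.
Import numFieldNormedType.Exports.

Local Open Scope classical_set_scope.
Local Open Scope ring_scope.

Definition boundary (T : topologicalType) (A : set T) : set T :=
  closure A `\` interior A.

(* Extended-real valued, so that an unbounded set has diameter +oo (the real
   supremum of an unbounded set would be the junk value 0). *)
Definition diameter (R : realType) (X : metricType R) (A : set X) : \bar R :=
  ereal_sup [set (mdist x y)%:E | x in A & y in A].

Definition continuum (R : realType) (X : metricType R) : Prop :=
  [/\ [set: X] !=set0, compact [set: X] & connected [set: X]].

Definition regular_curve (R : realType) (X : metricType R) : Prop :=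
  continuum X /\
  forall eps : R, 0 < eps -> forall x : X,
    exists U : set X, [/\ open U, U x, (diameter U < eps%:E)%E
      & finite_set (boundary U)].

Definition homeomorphism (T U : topologicalType) (f : T -> U) : Prop :=
  continuous f /\
  exists g : U -> T, [/\ cancel f g, cancel g f & continuous g].

Definition wandering (T : topologicalType) (f : T -> T) (x : T) : Prop :=
  exists U : set T, nbhs x U /\
    forall n : nat, (1 <= n)%N -> (iter n f @^-1` U) `&` U = set0.

Definition nonwandering_set (T : topologicalType) (f : T -> T) : set T :=
  [set x | ~ wandering f x].

(* Bowen-Dinaburg entropy through (n, eps)-separated sets:
   lim_(eps -> 0+) limsup_n (1/n) ln s_n(eps).
   s_n(eps) is an extended real, finite when X is compact; the limit over eps
   exists because entropy_at is nonincreasing in eps. *)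
Section entropy.
Context {R : realType} {X : metricType R}.
Variable f : X -> X.

Definition bowen_dist (n : nat) (x y : X) : R :=
  \big[Order.max/0]_(i < n) mdist (iter i f x) (iter i f y).

Definition separated (n : nat) (eps : R) (s : seq X) : Prop :=
  {in s &, forall x y, x != y -> eps < bowen_dist n x y}.

Definition max_separated (n : nat) (eps : R) : \bar R :=
  ereal_sup [set (size s)%:R%:E | s in [set s | uniq s /\ separated n eps s]].

Definition entropy_at (eps : R) : \bar R :=
  limn_esup (fun n => ((n%:R)^-1%:E * lne (max_separated n eps))%E).

Definition topological_entropy : \bar R :=
  lim (entropy_at eps @[eps --> 0^'+]).

End entropy.

Record hyperspace (R : realType) (X : metricType R) := Hyperspace {
  hyperset :> set X ;
  hyperset_neq0 : hyperset !=set0 ;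
  hyperset_compact : compact hyperset }.

Arguments hyperset_compact {R X} _ : rename.

HB.instance Definition _ (R : realType) (X : metricType R) :=
  gen_eqMixin (hyperspace X).
HB.instance Definition _ (R : realType) (X : metricType R) :=
  gen_choiceMixin (hyperspace X).

Section hausdorff_distance.
Context {R : realType} {X : metricType R}.
Implicit Types (x y : X) (A B C : hyperspace X).

Definition infdist x (B : set X) : R := inf [set mdist x y | y in B].

Definition excess (A B : set X) : R := sup [set infdist x B | x in A].

Definition hausdorff_dist A B : R := Num.max (excess A B) (excess B A).

Lemma infdist_le x y (B : set X) : B y -> infdist x B <= mdist x y.
Proof.
move=> By; apply: ge_inf; last by exists y.
by exists 0 => _ [z _ <-]; exact: mdist_ge0.
Qed.

Lemma le_infdist x B r :
  (forall y, hyperset B y -> r <= mdist x y) -> r <= infdist x B.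
Proof.
move=> h; apply: lb_le_inf; last by move=> _ [y By <-]; exact: h.
by have [y By] := hyperset_neq0 B; exists (mdist x y), y.
Qed.

Lemma infdist_ge0 x B : 0 <= infdist x B.
Proof. by apply: le_infdist => y _; exact: mdist_ge0. Qed.

Lemma infdist_triangle x y B : infdist x B <= mdist x y + infdist y B.
Proof.
rewrite -lerBlDl; apply: le_infdist => z Bz; rewrite lerBlDl.
exact: le_trans (infdist_le x Bz) (metric_triangle x y z).
Qed.

Lemma mdist_continuous x : continuous (mdist x : X -> R).
Proof.
move=> y; apply/cvgrPdist_lt => e e0.
have : \forall z \near y, ball y e z by exact: nbhsx_ballx.
apply: filterS => z; rewrite ballEmdist/= => yz.
apply: le_lt_trans yz; rewrite ler_norml; apply/andP; split.
  by rewrite lerBrDr addrC lerBlDr addrC [leRHS]addrC metric_triangle.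
by rewrite lerBlDr addrC (metric_sym y z) metric_triangle.
Qed.

Lemma hyperset_bounded x A : exists M : R, forall y, hyperset A y -> mdist x y <= M.
Proof.
have [_ [M MA]] : has_sup (mdist x @` A).
  apply: compact_has_sup; first exact/image_nonempty/hyperset_neq0.
  apply: continuous_compact; last exact: hyperset_compact.
  exact/continuous_subspaceT/mdist_continuous.
by exists M => y Ay; apply: MA; exists y.
Qed.

Lemma infdist_le_excess x A B : hyperset A x -> infdist x B <= excess A B.
Proof.
move=> Ax; apply: ub_le_sup; last by exists x.
have [y By] := hyperset_neq0 B; have [M MA] := hyperset_bounded y A.
exists M => _ [z Az <-]; apply: le_trans (infdist_le z By) _.
by rewrite metric_sym; exact: MA.
Qed.

Lemma excess_le A B r : (forall x, hyperset A x -> infdist x B <= r) -> excess A B <= r.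
Proof.
move=> h; apply: ge_sup; first exact/image_nonempty/hyperset_neq0.
by move=> _ [x Ax <-]; exact: h.
Qed.

Lemma excess_triangle A B C : excess A C <= excess A B + excess B C.
Proof.
apply: excess_le => x Ax; rewrite -lerBlDr.
apply: le_trans (infdist_le_excess B Ax); apply: le_infdist => y By.
rewrite lerBlDr; apply: le_trans (infdist_triangle x y C) _.
by rewrite lerD2l; exact: infdist_le_excess.
Qed.

Lemma excess_le0_subset A B : excess A B <= 0 -> hyperset A `<=` B.
Proof.
move=> AB0 x Ax.
have clB := compact_closed (@metric_hausdorff R X) (hyperset_compact B).
apply: clB => V /nbhs_ballP[e /= e0 xeV].
have : infdist x B < e.
  exact: le_lt_trans (infdist_le_excess B Ax) (le_lt_trans AB0 e0).
move=> /inf_lt[]; first by apply/image_nonempty/hyperset_neq0.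
by move=> _ [y By <-] xy; exists y; split=> //; apply: xeV; rewrite ballEmdist.
Qed.

Lemma hausdorff_distxx A : hausdorff_dist A A = 0.
Proof.
rewrite /hausdorff_dist maxxx; apply/eqP; rewrite eq_le; apply/andP; split.
  by apply: excess_le => x Ax; rewrite -(mdistxx x) infdist_le.
have [x Ax] := hyperset_neq0 A.
exact: le_trans (infdist_ge0 x A) (infdist_le_excess A Ax).
Qed.

Lemma hausdorff_dist_sym A B : hausdorff_dist A B = hausdorff_dist B A.
Proof. by rewrite /hausdorff_dist maxC. Qed.

Lemma hausdorff_dist_triangle B A C :
  hausdorff_dist A C <= hausdorff_dist A B + hausdorff_dist B C.
Proof.
rewrite {1}/hausdorff_dist ge_max; apply/andP; split.
  apply: le_trans (excess_triangle A B C) _.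
  by apply: lerD; rewrite /hausdorff_dist le_max lexx.
apply: le_trans (excess_triangle C B A) _.
by rewrite addrC; apply: lerD; rewrite /hausdorff_dist le_max lexx orbT.
Qed.

Lemma hyperspace_eq A B : hyperset A = hyperset B -> A = B.
Proof.
case: A B => [A A0 Ac] [B B0 Bc] /= AB; subst B.
by congr Hyperspace; exact: Prop_irrelevance.
Qed.

Lemma hausdorff_dist_positivity A B : hausdorff_dist A B = 0 -> A = B.
Proof.
move=> AB0; apply/hyperspace_eq/seteqP.
by split; apply: excess_le0_subset; rewrite -AB0 /hausdorff_dist le_max lexx
  ?orbT.
Qed.

End hausdorff_distance.

HB.instance Definition _ (R : realType) (X : metricType R) :=
  isMetric.Build R (hyperspace X) (@hausdorff_distxx R X)
    (@hausdorff_dist_positivity R X) (@hausdorff_dist_sym R X)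
    (@hausdorff_dist_triangle R X).

Section hypermap.
Context {R : realType} {X : metricType R} (f : X -> X).
Hypothesis cf : continuous f.

Definition hypermap (A : hyperspace X) : hyperspace X :=
  @Hyperspace R X (f @` A) (image_nonempty f (hyperset_neq0 A))
    (continuous_compact (continuous_subspaceT cf) (hyperset_compact A)).

End hypermap.

Lemma homeomorphism_continuous (T U : topologicalType) (f : T -> U) :
  homeomorphism f -> continuous f.
Proof. by case. Qed.

(* Main.v *)
Require Import Defs.
From mathcomp Require Import all_boot all_order all_algebra.
From mathcomp Require Import all_classical all_reals all_analysis.
From mathcomp Require Import zify lra.

Set Implicit Arguments.
Unset Strict Implicit.
Unset Printing Implicit Defensive.

Import Order.TTheory GRing.Theory Num.Theory.
Import numFieldNormedType.Exports.

Local Open Scope classical_set_scope.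
Local Open Scope ring_scope.

(* Notation: [T n] ([n : int]) are the two-sided iterates of [f]; for an ultrafilter [U] on [int],
   [ulim U x] is the limit of [T n x] along [U]; "periodic" means not [aperiodic].

   If [U] is a neighbourhood of a wandering point, choose [k] points [y_i] in [U]; this is possible
   since [X] is connected. At time [j] the set of the [f^-j (y_(w j))], [j < n], meets [U] exactly
   in [y_(w j)], so the [k^n] words [w] give an [(n, eps)]-separated set and the entropy is at least
   [ln k].

   If no point wanders, all [ulim U] are injective, which for a regular curve amounts to
   equicontinuity of the [T n]; then finitely many pieces of [X] describe the orbit of a compact
   set at all times, and the entropy is [0]. Injectivity rests on two facts. First, if small
   connected neighbourhoods of [z] are spread by the [T n] across the finite boundary of an open
   set, then [z] is the limit along the opposite ultrafilter of a boundary point. Hence a fibre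
   of [ulim U] containing points on both sides of a finite boundary also meets that boundary.
   Second, fibres over an aperiodic point [x] have disjoint translates (lying over the [T n x]),
   of which only finitely many meet a given finite set: such fibres consist of points asymptotic
   in both directions. *)

(** * Compactness, connectedness and finite boundaries *)

(** Otherwise [C] meets [V] in a set that is open and closed in [C], non-empty and proper. *)
Lemma connected_boundary (T : topologicalType) (C V : set T) (a c : T) :
  connected C -> open V -> C a -> C c -> V a -> ~ V c ->
  exists2 b, C b & boundary V b.
Proof.
move=> Ccon oV Ca Cc Va Vc; apply: contrapT => noB.
have clV x : C x -> closure V x -> V x.
  move=> Cx cVx; apply: contrapT => Vx; apply: noB; exists x => //.
  by split=> //; rewrite (interior_id V).1.
suff /seteqP[_ /(_ c Cc)[]] : C `&` V = C by [].
apply: Ccon; first by exists a.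
- by exists V.
- exists (closure V); first exact: closed_closure.
  by apply/seteqP; split=> x [Cx Vx]; split=> //; [exact: subset_closure|exact: clV].
Qed.

(* The complements of the subsets of [K] with property [P] generate a filter, whose cluster
   points contradict the local hypothesis when it is proper. *)
Lemma compact_ind (T : topologicalType) (P : set T -> Prop) (K : set T) :
  compact K -> P set0 -> (forall A B, A `<=` B -> P B -> P A) ->
  (forall A B, P A -> P B -> P (A `|` B)) ->
  (forall x, K x -> exists2 N, nbhs x N & P N) -> P K.
Proof.
move=> cK P0 PS PU Ploc; apply: contrapT => nPK.
have FP : ProperFilter [set A | P (K `\` A)].
  split; first by rewrite /= setD0.
  split=> [|A B /= PA PB|A B AB /=]; first by rewrite /= setDT.
    by rewrite setDIr; exact: PU.
  by apply: PS => x [Kx nB]; split=> // /AB.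
have [|x [Kx xcl]] := cK _ FP; first by rewrite /= setDv.
have [N nN PN] := Ploc x Kx.
have [|y [+ Ny]] := xcl (~` N) N _ nN; last exact.
by apply: PS PN => y [_] /contrapT.
Qed.

(** * Regular curves are locally connected *)

Section regular_curves.
Context {R : realType} {X : metricType R}.
Implicit Types (x y z : X) (A B C U V W : set X).

Lemma mdist_diameter U x y (e : R) :
  (diameter U < e%:E)%E -> U x -> U y -> mdist x y < e.
Proof.
move=> dU Ux Uy; rewrite -lte_fin; apply: le_lt_trans dU.
by apply: ereal_sup_ubound; exists x => //; exists y.
Qed.

Lemma nbhs_mdist x W : nbhs x W ->
  exists2 e : R, 0 < e & forall y, mdist x y < e -> W y.
Proof.
move=> /nbhs_ballP[e /= e0 eW]; exists e => // y xy.
by apply: eW; rewrite ballEmdist.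
Qed.

Lemma mdist_nbhs x (e : R) : 0 < e -> nbhs x [set y | mdist x y < e].
Proof. by move=> e0; rewrite -ballEmdist; exact: nbhsx_ballx. Qed.

Lemma closure_mdist A x (e : R) : closure A x -> 0 < e ->
  exists2 y, A y & mdist x y < e.
Proof. by move=> cA e0; have [y [Ay xy]] := cA _ (mdist_nbhs x e0); exists y. Qed.

Lemma mdist_closed_ball x (e : R) : closed [set y | mdist x y <= e].
Proof.
move=> y /closure_mdist clB /=; apply/ler_addgt0Pr => d d0.
have [z xz yz] := clB _ d0; rewrite /= in xz.
apply: le_trans (metric_triangle x z y) _; rewrite (metric_sym z).
by rewrite lerD // ltW.
Qed.

Lemma disjoint_nbhs (x y : X) : x <> y ->
  exists A B, [/\ nbhs x A, nbhs y B & forall a, A a -> ~ B a].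
Proof.
move=> xy; apply: contrapT => noAB; apply: xy.
apply: (@metric_hausdorff _ X) => A B nA nB; apply: contrapT => AB.
by apply: noAB; exists A, B; split=> // a Aa Ba; apply: AB; exists a.
Qed.

Hypothesis regX : regular_curve X.

Lemma regular_nbhs x W : nbhs x W ->
  exists V, [/\ open V, V x, closure V `<=` W & finite_set (boundary V)].
Proof.
move=> /nbhs_mdist[e e0 eW]; have e20 : 0 < e / 2 by rewrite divr_gt0.
have [V [oV Vx dV fV]] := regX.2 _ e20 x.
exists V; split=> // y /closure_mdist /(_ e20)[z Vz yz]; apply: eW.
apply: le_lt_trans (metric_triangle x z y) _; rewrite (splitr e) (metric_sym z).
by apply: ltrD => //; exact: mdist_diameter dV Vx Vz.
Qed.

Lemma connX : connected [set: X]. Proof. by case: regX => -[]. Qed.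

Lemma compX : compact [set: X]. Proof. by case: regX => -[]. Qed.

Lemma clopen_setT A x : open A -> closed A -> A x -> A = setT.
Proof.
move=> oA cA Ax; apply: connX; first by exists x.
  by exists A => //; rewrite setTI.
by exists A => //; rewrite setTI.
Qed.

(* A disconnection of the closed set [K `&` A] leaves out a piece that meets the boundary
   of [U], since [X] is connected; hence finitely many such steps isolate a connected
   piece containing [x]. *)
Lemma connected_closed_piece U x (s : seq X) A : open U -> U x ->
  A x -> closed A -> closed (closure U `\` A) -> A `<=` closure U ->
  A `&` boundary U `<=` [set` s] ->
  exists C, [/\ connected C, nbhs x C & C `<=` closure U].
Proof.
move=> oU Ux; have [n] := ubnP (size s); elim: n s A => // n IH s A sn.
move=> Ax cA cDA AU As.
have [Acon|/connectedPn[E [E0 AE sepE]]] := pselect (connected A).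
  exists A; split=> //.
  have : nbhs x (U `&` ~` (closure U `\` A)).
    apply: filterI; first exact: open_nbhs_nbhs.
    by apply: open_nbhs_nbhs; split; [exact: closed_openC|move=> [_ /(_ Ax)]].
  apply: filterS => y [Uy]; apply: contra_notP => nAy; split=> //.
  exact: subset_closure.
wlog Ex : E E0 AE sepE / E false x.
  move=> wl; have : A x by []. rewrite AE => -[|] Ex; first exact: (wl E).
  apply: (wl (E \o negb)) => // [b|/=|]; first exact: E0.
    by rewrite AE setUC.
  by rewrite separatedC.
case: sepE => sep1 sep2.
have clE b : closed (E b).
  move=> y cy; have Ay : A y.
    by apply: cA; apply: closureS cy; rewrite AE; case: b => z Ez; [right|left].
  move: (Ay); rewrite AE; case: b cy => cy [Ef|Et] //; exfalso.
    by have : (E false `&` closure (E true)) y by []; rewrite sep2.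
  by have : (closure (E false) `&` E true) y by []; rewrite sep1.
have disjE y : E false y -> E true y -> False.
  move=> Ef Et; have : (E false `&` closure (E true)) y.
    by split=> //; exact: subset_closure.
  by rewrite sep2.
(* Otherwise [E true] would be open as well as closed, hence all of [X], although [x] lies in
   [E false]. *)
have [b Etb bb] : exists2 b, E true b & boundary U b.
  apply: contrapT => nb.
  have EU : E true `<=` U.
    move=> y Ey; apply: contrapT => Uy; apply: nb; exists y => //; split.
      by apply: AU; rewrite AE; right.
    by rewrite (interior_id U).1.
  have oE : open (E true).
    have -> : E true = U `&` ~` (E false `|` (closure U `\` A)).
      apply/seteqP; split=> [y Ey|y [Uy ny]].
        split; first exact: EU.
        by move=> [/disjE/(_ Ey)//|[_]]; apply; rewrite AE; right.
      have Ay : A y.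
        apply: contrapT => nA; apply: ny; right; split=> //; exact: subset_closure.
      by move: Ay; rewrite AE => -[Ey|//]; exfalso; apply: ny; left.
    by apply: openI => //; apply: closed_openC; exact: closedU.
  have [e0 Ee0] := E0 true.
  have ET := clopen_setT oE (clE true) Ee0.
  by apply: (disjE x Ex); rewrite ET.
have sb : b \in s by have := As b; apply; split=> //; rewrite AE; right.
apply: (IH [seq y <- s | y != b] (E false)) => //.
- apply: (@leq_trans (size s)); last by rewrite -ltnS.
  rewrite size_filter -(count_predC (fun y => y != b) s) -addn1 leq_add2l.
  by rewrite -has_count; apply/hasP; exists b => //=; rewrite negbK.
- have -> : closure U `\` E false = E true `|` (closure U `\` A); last exact: closedU.
  apply/seteqP; split=> [y [Uy nE]|y].
    have [Ay|nAy] := pselect (A y); last by right.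
    by left; move: Ay; rewrite AE => -[].
  move=> [Ey|[Uy nA]]; split=> //.
  + by apply: AU; rewrite AE; right.
  + by move=> /disjE/(_ Ey).
  + by move=> Ey; apply: nA; rewrite AE; left.
- by move=> y Ey; apply: AU; rewrite AE; left.
- move=> y [Ey by_]; rewrite /= mem_filter; apply/andP; split.
    by apply/eqP => yb; apply: (disjE y Ey); rewrite yb.
  by have := As y; apply; split=> //; rewrite AE; left.
Qed.

Lemma connected_nbhs x W : nbhs x W ->
  exists C, [/\ connected C, nbhs x C & C `<=` W].
Proof.
move=> /regular_nbhs[U [oU Ux UW /finite_seqP[s sE]]].
have [| | | | |C [cC nC CU]] := @connected_closed_piece U x s (closure U) oU Ux.
- exact: subset_closure.
- exact: closed_closure.
- by rewrite setDv; exact: closed0.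
- by [].
- by rewrite sE => y [].
- by exists C; split=> //; exact: subset_trans UW.
Qed.

End regular_curves.

(** * Ultrafilters on the integers and two-sided iterates *)

Lemma ultraP T (U : set_system T) : ProperFilter U -> (forall A, U A \/ U (~` A)) -> UltraFilter U.
Proof.
move=> PU UC; split=> // G PG UG; apply/seteqP; split=> // A GA.
have [//|/UG GnA] := UC A; exfalso.
by have [x [Ax]] := filter_ex (filterI GA GnA).
Qed.

Section ultrafilters.
Context {T : Type}.
Implicit Types (U : set_system T) (A : set T).

Lemma ultra_fmap (S : Type) (h : T -> S) U : UltraFilter U -> UltraFilter (h @ U).
Proof.
move=> UU; apply: ultraP => A.
by have [|] := in_ultra_setVsetC (h @^-1` A) UU; [left|right].
Qed.

Lemma ultra_base (I : Type) (D : set I) (B : I -> set T) :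
  D !=set0 -> (forall i j, D i -> D j -> exists2 k, D k & B k `<=` B i `&` B j) ->
  (forall i, D i -> B i !=set0) ->
  exists U, UltraFilter U /\ forall i, D i -> U (B i).
Proof.
move=> D0 DI B0; have FF := filter_from_filter D0 DI.
have [U [UU FU]] := ultraFilterLemma (filter_from_proper FF B0).
by exists U; split=> // i Di; apply: FU; exists i.
Qed.

Lemma ultra_not U A : UltraFilter U -> ~ U A -> U (~` A).
Proof. by move=> UU nA; have [|] := in_ultra_setVsetC A UU. Qed.

(** Pigeonhole: an ultrafilter contains one cell of any finite partition. *)
Lemma ultra_bounded_residue (U : set_system T) (r : T -> nat) (k : nat) :
  UltraFilter U -> U [set n | (r n < k)%N] -> exists j, U [set n | r n = j].
Proof.
move=> UU; elim: k => [|k IH] Uk; first by have [] := filter_ex Uk.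
have [|nk] := in_ultra_setVsetC [set n | r n = k] UU; first by exists k.
apply: IH; apply: filterS2 Uk nk => n /=.
by rewrite ltnS leq_eqVlt => /orP[/eqP|].
Qed.

End ultrafilters.

Definition opp_filter (U : set_system int) : set_system int := -%R @ U.

(** The sum, in the Stone-Cech compactification of the integers, of the opposite of [U] and [U]; it
    serves to iterate limits. *)
Definition sub_filter (U : set_system int) : set_system int :=
  [set A | U [set a | U [set b | A (b - a)]]].

(** For ultrafilters, the opposite of being principal: times tend to infinity in absolute value. *)
Definition free_filter (U : set_system int) : Prop :=
  forall k : nat, U [set n : int | (k <= `|n|)%N].

Lemma opp_filterK U : opp_filter (opp_filter U) = U.
Proof.
apply/funext => A; rewrite /opp_filter /fmap /=; congr (U _).
by apply/funext => n /=; rewrite opprK.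
Qed.

Instance ultra_opp_filter U : UltraFilter U -> UltraFilter (opp_filter U).
Proof. exact: ultra_fmap. Qed.

Instance ultra_sub_filter U : UltraFilter U -> UltraFilter (sub_filter U).
Proof.
have subE A : sub_filter U A = U [set a | U [set b | A (b - a)]] by [].
move=> UU; apply: ultraP => [|A]; last first.
  have [|Un] := in_ultra_setVsetC [set a | U [set b | A (b - a)]] UU; first by left.
  by right; rewrite subE; apply: filterS Un => a; exact: ultra_not.
split; first by move=> /(@filter_ex _ U)[a /(@filter_ex _ U)[]].
split=> [|A B|A B AB]; rewrite !subE.
- by apply: filterE => a; exact: filterT.
- by apply: filterS2 => a; exact: filterI.
- by apply: filterS => a; apply: filterS => b; exact: AB.
Qed.

Lemma opp_filter_free U : UltraFilter U -> free_filter U -> free_filter (opp_filter U).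
Proof.
move=> UU FU k; rewrite /opp_filter /fmap /=; apply: filterS (FU k) => n /=.
by rewrite abszN.
Qed.

Lemma sub_filter_free U : UltraFilter U -> free_filter U -> free_filter (sub_filter U).
Proof.
move=> UU FU k; rewrite /sub_filter /=.
apply: filterE => a; apply: filterS (FU (k + `|a|)%N) => b /=; lia.
Qed.

Section two_sided_iterates.
Context {X : Type}.
Variables f g : X -> X.

Definition itz (n : int) : X -> X :=
  match n with Posz k => iter k f | Negz k => iter k.+1 g end.

Hypotheses (fK : cancel f g) (gK : cancel g f).

Lemma itzS n x : itz (n + 1) x = f (itz n x).
Proof.
case: n => [k|[|k]]; first by rewrite -PoszD addn1.
  by rewrite (_ : Negz 0 + 1 = 0) //= gK.
by rewrite (_ : Negz k.+1 + 1 = Negz k) ?[RHS]gK //; lia.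
Qed.

Lemma itzB1 n x : itz (n - 1) x = g (itz n x).
Proof. by rewrite -{2}(subrK 1 n) itzS fK. Qed.

Lemma itzD m n x : itz (m + n) x = itz m (itz n x).
Proof.
elim: m => [|m IH|m IH]; first by rewrite add0r.
  by rewrite -addn1 PoszD addrAC !itzS IH.
by rewrite -addn1 PoszD opprD addrAC !itzB1 IH.
Qed.

Lemma itzC m n x : itz m (itz n x) = itz n (itz m x).
Proof. by rewrite -!itzD addrC. Qed.

Lemma itzK n : cancel (itz n) (itz (- n)).
Proof. by move=> x; rewrite -itzD addNr. Qed.

Lemma itzNK n : cancel (itz (- n)) (itz n).
Proof. by move=> x; rewrite -itzD addrN. Qed.

Lemma itz_inj n : injective (itz n).
Proof. exact: can_inj (itzK n). Qed.

Lemma itz_mul_period m x q : itz m x = x -> itz (q * m) x = x.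
Proof.
move=> mx; elim: q => [|q IH|q IH]; first by rewrite mul0r.
  by rewrite -addn1 PoszD mulrDl mul1r itzD mx.
by rewrite -addn1 PoszD opprD mulrBl mul1r itzD -{1}mx itzK IH.
Qed.

End two_sided_iterates.

Lemma itz_continuous (X : topologicalType) (f g : X -> X) n :
  continuous f -> continuous g -> continuous (itz f g n).
Proof.
move=> cf cg; case: n => k /=; [|move: k.+1 => {}k].
  by elim: k => [|k IH] x //=; exact: (continuous_comp (IH x) (cf _)).
by elim: k => [|k IH] x //=; exact: (continuous_comp (IH x) (cg _)).
Qed.

(** * Limits of iterates along ultrafilters *)

Section dynamics.
Context {R : realType} {X : metricType R}.
Variables f g : X -> X.
Hypotheses (regX : regular_curve X).
Hypotheses (fK : cancel f g) (gK : cancel g f).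
Hypotheses (cf : continuous f) (cg : continuous g).

Local Notation T := (itz f g).
Local Notation TD := (itzD fK gK).
Local Notation TC := (itzC fK gK).
Local Notation TK := (itzK fK gK).
Local Notation TNK := (itzNK fK gK).
Local Notation Tinj := (itz_inj fK gK).

Let cT n : continuous (T n).
Proof. exact: itz_continuous. Qed.

Lemma itz_nbhs n x W : nbhs (T n x) W -> nbhs x (T n @^-1` W).
Proof. exact: cT. Qed.

(** For an ultrafilter the limit exists by compactness and is unique; the default [x] stands in when
    there is none. *)
Definition ulim (U : set_system int) (x : X) : X :=
  xget x [set c | forall W, nbhs c W -> U [set n | W (T n x)]].

Lemma ulimP U x W : UltraFilter U -> nbhs (ulim U x) W -> U [set n | W (T n x)].
Proof.
move=> UU; rewrite /ulim; case: xgetP => [y _ yP /yP //|noc _]; exfalso.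
have : compact [set: X] by exact: compX.
rewrite compact_ultra => /(_ ((fun n => T n x) @ U)) [||c [_ cvc]].
- exact: ultra_fmap.
- exact: (@filterT _ U).
- by apply: (noc c) => V /cvc.
Qed.

Lemma ulim_eq U x c : UltraFilter U ->
  (forall W, nbhs c W -> U [set n | W (T n x)]) -> ulim U x = c.
Proof.
move=> UU cW; apply: (@metric_hausdorff _ X) => A B nA nB.
have [n [An Bn]] := filter_ex (filterI (ulimP UU nA) (cW _ nB)).
by exists (T n x).
Qed.

Lemma ulim_neq U x c : UltraFilter U -> ulim U x <> c ->
  exists2 W, nbhs c W & U [set n | ~ W (T n x)].
Proof.
move=> UU xc; apply: contrapT => noW; apply: xc; apply: ulim_eq => // W nW.
apply: contrapT => /(ultra_not UU) nUW; apply: noW; exists W => //.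
Qed.

Lemma ulim_itz U s x : UltraFilter U -> ulim U (T s x) = T s (ulim U x).
Proof.
move=> UU; apply: ulim_eq => W /itz_nbhs/(ulimP UU).
by apply: filterS => n /=; rewrite TC.
Qed.

(** Take the limit over [b] first in [T (b - a) x = T (- a) (T b x)]; [T (- a)] is continuous. *)
Lemma ulim_sub U x : UltraFilter U ->
  ulim (sub_filter U) x = ulim (opp_filter U) (ulim U x).
Proof.
move=> UU; apply: ulim_eq => W nW.
have [V [oV Vx VW _]] := regular_nbhs regX nW.
have := ulimP (ultra_opp_filter UU) (open_nbhs_nbhs (conj oV Vx)).
rewrite /opp_filter /sub_filter /fmap /=; apply: filterS => a /= Va.
have := @itz_nbhs (- a) (ulim U x) V (open_nbhs_nbhs (conj oV Va)).
move=> /(ulimP UU); apply: filterS => b /=; rewrite -TD addrC => Vb.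
by apply: VW; exact: subset_closure.
Qed.

Definition aperiodic x := forall n : int, n != 0 -> T n x <> x.

Lemma aperiodicPn x : ~ aperiodic x -> exists2 m : int, m != 0 & T m x = x.
Proof.
by move=> /existsNP[m /not_implyP[m0 /contrapT mx]]; exists m.
Qed.

Lemma aperiodic_itz x n : aperiodic x -> aperiodic (T n x).
Proof. by move=> ax m m0; rewrite TC => /Tinj; exact: ax. Qed.

Lemma aperiodic_inj x : aperiodic x -> injective (T^~ x).
Proof.
move=> ax m n /= mn; apply/eqP; rewrite -subr_eq0; apply/negP => /negP mn0.
by apply: (ax (m - n)) => //; rewrite addrC TD mn TK.
Qed.

(** Were no [b] sent to [z], each would avoid a neighbourhood of [z] along [U]; intersect these
    finitely many. *)
Lemma finite_ulim U (B : set X) z : UltraFilter U -> finite_set B ->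
  (forall N, nbhs z N -> U [set n | exists2 b, B b & N (T n b)]) ->
  exists2 b, B b & ulim U b = z.
Proof.
move=> UU /finite_seqP[s ->] UN; apply: contrapT => noz.
suff [N nN UnN] : exists2 N, nbhs z N &
    U [set n | forall b, b \in s -> ~ N (T n b)].
  by have [n [[b /= bs Nb] /(_ b bs)]] := filter_ex (filterI (UN N nN) UnN).
have {noz} : forall b, b \in s -> ulim U b <> z.
  by move=> b bs bz; apply: noz; exists b.
elim: s {UN} => [|b s IH] noz.
  by exists setT; [exact: filterT|apply: filterE].
have [|N nN UnN] := IH; first by move=> c cs; apply: noz; rewrite inE cs orbT.
have [|W nW UnW] := @ulim_neq U b z UU; first by apply: noz; rewrite inE eqxx.
exists (N `&` W); first exact: filterI.
apply: filterS2 UnN UnW => n /= Nn Wn c; rewrite inE => /orP[/eqP->|/Nn NN] [Nc Wc].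
  exact: Wn.
exact: NN.
Qed.

(* If the homeomorphisms [T n] keep spreading arbitrarily small connected neighbourhoods of [z]
   across the finite boundary of [V], then the inverse images of a fixed boundary point
   accumulate at [z]. *)
Lemma boundary_ulim U z V : UltraFilter U -> open V -> finite_set (boundary V) ->
  (forall N, nbhs z N ->
     U [set n | exists a c, [/\ N a, N c, V (T n a) & ~ V (T n c)]]) ->
  exists2 b, boundary V b & ulim (opp_filter U) b = z.
Proof.
move=> UU oV fV UN; apply: finite_ulim => // N nN.
have [C [cC nC CN]] := connected_nbhs regX nN.
rewrite /opp_filter /fmap /=; apply: filterS (UN C nC) => n /= [a [c [Ca Cc Va Vc]]].
have [|||_ [w Cw <-] bw] :=
  @connected_boundary X (T n @` C) V (T n a) (T n c) _ oV _ _ Va Vc.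
- apply: connected_continuous_connected => //.
  exact: continuous_subspaceT.
- by exists a.
- by exists c.
- by exists (T n w) => //; rewrite TK; exact: CN.
Qed.

(** Near the common limit lie [T n z1] and [T n z2], which [T (- n)] returns to either side of the
    boundary: [boundary_ulim] applies to the opposite ultrafilter. *)
Lemma ulim_fiber_boundary U z1 z2 V : UltraFilter U -> open V ->
  finite_set (boundary V) -> ulim U z1 = ulim U z2 -> V z1 -> ~ V z2 ->
  exists2 b, boundary V b & ulim U b = ulim U z1.
Proof.
move=> UU oV fV z12 V1 V2; rewrite -{1}(opp_filterK U).
apply: boundary_ulim => // N nN; rewrite /opp_filter /fmap /=.
have := nN; rewrite {1}z12 => nN'.
apply: filterS2 (ulimP UU nN) (ulimP UU nN') => n /= N1 N2.
by exists (T n z1), (T n z2); rewrite !TK.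
Qed.

(** Finitely many open sets of diameter below [e] with finite boundary cover [X]; [F] collects their
    boundaries and serves all ultrafilters at once. *)
Lemma finite_separator (e : R) : 0 < e ->
  exists2 F : set X, finite_set F & forall U a c, UltraFilter U ->
    e <= mdist a c -> ulim U a = ulim U c -> exists2 b, F b & ulim U b = ulim U a.
Proof.
move=> e0.
suff [F fF HF] : exists2 F, finite_set F & forall a c, [set: X] a -> e <= mdist a c ->
    exists V, [/\ open V, finite_set (boundary V), boundary V `<=` F, V a & ~ V c].
  exists F => // U a c UU eac ac; have [V [oV fV VF Va Vc]] := HF a c I eac.
  have [b bV bU] := ulim_fiber_boundary UU oV fV ac Va Vc.
  by exists b => //; exact: VF.
apply: (compact_ind (compX regX)
  (P := fun A => exists2 F, finite_set F & forall a c, A a -> e <= mdist a c ->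
    exists V, [/\ open V, finite_set (boundary V), boundary V `<=` F, V a & ~ V c])).
- by exists set0.
- by move=> A B AB [F fF BF]; exists F => // a c /AB; exact: BF.
- move=> A B [F fF AF] [G fG BG]; exists (F `|` G); first by rewrite finite_setU.
  move=> a c [Aa|Ba] eac.
    have [V [oV fV VF Va Vc]] := AF a c Aa eac.
    by exists V; split=> // b /VF; left.
  have [V [oV fV VG Va Vc]] := BG a c Ba eac.
  by exists V; split=> // b /VG; right.
- move=> x _; have [V [oV Vx dV fV]] := regX.2 _ e0 x.
  exists V; first exact: open_nbhs_nbhs.
  exists (boundary V) => // a c Va eac; exists V; split=> // Vc.
  by have := mdist_diameter dV Va Vc; rewrite ltNge eac.
Qed.

(* The translates [T s] of the fibre over an aperiodic point are fibres over distinct points, and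
   those of diameter at least [e] all meet the same finite set. *)
Lemma ulim_fiber_small U x (e : R) : UltraFilter U -> aperiodic x -> 0 < e ->
  exists k : nat, forall s : int, (k <= `|s|)%N -> forall z1 z2,
    ulim U z1 = x -> ulim U z2 = x -> mdist (T s z1) (T s z2) < e.
Proof.
move=> UU ax e0; have [F /finite_seqP[r ->] HF] := finite_separator e0.
have [k Hk] : exists k : nat, forall (s : int) b, b \in r ->
    ulim U b = T s x -> (`|s| < k)%N.
  elim: r {HF} => [|b r [k IH]]; first by exists 0%N.
  have [[s0 bs0]|nob] := pselect (exists s0 : int, ulim U b = T s0 x).
    exists (maxn k `|s0|.+1) => s c; rewrite inE => /orP[/eqP->|/IH + cs].
      by rewrite bs0 => /(aperiodic_inj ax) <-; rewrite leq_max leqnn orbT.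
    by move=> /(_ _ cs); rewrite leq_max => ->.
  exists k => s c; rewrite inE => /orP[/eqP-> bs|]; last exact: IH.
  by exfalso; apply: nob; exists s.
exists k => s ks z1 z2 z1x z2x; rewrite ltNge; apply/negP => ez.
have [|b br] := HF U (T s z1) (T s z2) UU ez; first by rewrite !ulim_itz // z1x z2x.
rewrite ulim_itz // z1x => bs.
by have := Hk s b br bs; rewrite ltnNge ks.
Qed.

(** At remote times the fibre is uniformly small, so its points share their limit along a free
    ultrafilter; uniformity extends this to the closure. *)
Lemma ulim_fiber_asymptotic U x z0 z W : UltraFilter U -> UltraFilter W ->
  free_filter W -> aperiodic x -> ulim U z0 = x ->
  closure [set z | ulim U z = x] z -> ulim W z = ulim W z0.
Proof.
move=> UU UW fW ax z0x clz; apply: mdist_positivity; apply: le_anti.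
rewrite mdist_ge0 andbT; apply/ler_addgt0Pr => e e0; rewrite add0r.
have e4 : 0 < e / 4 by rewrite divr_gt0.
have [k Hk] := ulim_fiber_small UU ax e4.
have := ulimP UW (mdist_nbhs (ulim W z) e4).
have := ulimP UW (mdist_nbhs (ulim W z0) e4).
move=> W0 W1; have [s /= [[sz sz0] ks]] := filter_ex (filterI (filterI W1 W0) (fW k)).
have [w [/= wx wz]] := clz _ (itz_nbhs (mdist_nbhs (T s z) e4)).
have := Hk s ks w z0 wx z0x.
have := metric_triangle (ulim W z) (T s z) (ulim W z0).
have := metric_triangle (T s z) (T s w) (ulim W z0).
have := metric_triangle (T s w) (T s z0) (ulim W z0).
rewrite (metric_sym (T s z0)); lra.
Qed.

Lemma ulim_fiber_closed U x z : UltraFilter U -> free_filter U -> aperiodic x ->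
  closure [set z | ulim U z = x] z -> ulim U z = x.
Proof.
move=> UU fU ax clz; have [z0 [/= z0x _]] := clz setT (@filterT _ _ _).
by rewrite (ulim_fiber_asymptotic UU UU fU ax z0x clz).
Qed.

Lemma ulim_principal U n x : UltraFilter U -> U [set n] -> ulim U x = T n x.
Proof.
move=> UU Un; apply: ulim_eq => W nW; apply: filterS Un => m /= ->.
exact: nbhs_singleton nW.
Qed.

Lemma free_or_principal U : UltraFilter U -> free_filter U \/ exists n, U [set n].
Proof.
move=> UU; have [|/existsNP[k /(ultra_not UU) Uk]] := pselect (free_filter U).
  by left.
right; have [|j Uj] := @ultra_bounded_residue _ U (fun n : int => `|n|%N) k UU.
  by apply: filterS Uk => n /= /negP; rewrite ltnNge.
have [Un|Un] := in_ultra_setVsetC [set j%:Z] UU; first by exists j%:Z.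
exists (- j%:Z); apply: filterS2 Uj Un => n /= nj nj'.
by case: n nj nj' => [n|n] /=; lia.
Qed.

Lemma ulim_free U x : UltraFilter U -> (forall n, T n x <> ulim U x) -> free_filter U.
Proof.
move=> UU xn; have [//|[n Un]] := free_or_principal UU.
by have := xn n; rewrite (ulim_principal x UU Un).
Qed.

Lemma ulim_periodic_fixed U m x : UltraFilter U -> T m x = x -> T m (ulim U x) = ulim U x.
Proof. by move=> UU mx; rewrite -ulim_itz // mx. Qed.

Lemma aperiodic_of_ulim U x : UltraFilter U -> aperiodic (ulim U x) -> aperiodic x.
Proof.
by move=> UU ax m m0 mx; apply: (ax m m0); exact: ulim_periodic_fixed.
Qed.

Lemma aperiodic_separated_nbhs x k : aperiodic x -> exists2 N, nbhs x N &
  forall s : int, s != 0 -> (`|s| < k)%N -> forall a, N a -> ~ N (T s a).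
Proof.
move=> ax; have sep s : s != 0 ->
    exists2 N, nbhs x N & forall a, N a -> ~ N (T s a).
  move=> /ax/disjoint_nbhs[A [B [nA nB AB]]]; exists (B `&` T s @^-1` A).
    by apply: filterI => //; exact: itz_nbhs.
  by move=> a [_ Aa] [Ba _]; exact: AB Aa Ba.
elim: k => [|k [N nN HN]]; first by exists setT => //; exact: filterT.
have [->|k0] := eqVneq k 0%N.
  by exists setT; [exact: filterT|move=> s s0; lia].
have [N1 nN1 HN1] := sep k%:Z ltac:(lia).
have [N2 nN2 HN2] := sep (- k%:Z) ltac:(lia).
exists (N `&` (N1 `&` N2)); first by do 2?apply: filterI.
move=> s s0; rewrite ltnS leq_eqVlt => /orP[/eqP sk|sk] a [Na [N1a N2a]] [].
  move=> _ [N1s N2s]; have [E|E] : s = k%:Z \/ s = - k%:Z by lia.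
    by apply: (HN1 a N1a); rewrite -E.
  by apply: (HN2 a N2a); rewrite -E.
by move=> Ns _; exact: (HN s s0 sk a Na).
Qed.

(** The fibre over [z] accumulates at [z']: if [y] is not close to [z'], then [T (- n)] takes [z]
    close to [z'] but the nearby point [T n y] back to [y], so a boundary point near [z'] lies in
    the fibre. *)
Lemma ulim_return U y : UltraFilter U -> free_filter U -> aperiodic (ulim U y) ->
  ulim U (ulim (opp_filter U) (ulim U y)) = ulim U y.
Proof.
move=> UU fU; set z := ulim U y => az; set z' := ulim (opp_filter U) z.
apply: ulim_fiber_closed => // M nM.
have [My|nMy] := pselect (M y); first by exists y.
have [V [oV Vz' VM fV]] := regular_nbhs regX nM.
have [|b bV bz] := @boundary_ulim (opp_filter U) z V _ oV fV.
  move=> N nN; have := ulimP (ultra_opp_filter UU) (open_nbhs_nbhs (conj oV Vz')).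
  rewrite /opp_filter /fmap /=; apply: filterS2 (ulimP UU nN) => n /= Nn Vn.
  exists z, (T n y); split=> //; first exact: nbhs_singleton nN.
  by rewrite TK => /(@subset_closure _ V)/VM.
exists b; split; first by move: bz; rewrite opp_filterK.
by apply: VM; case: bV.
Qed.

(** * Recurrence in the absence of wandering points *)

Hypothesis nonwand : forall x, ~ wandering f x.

Lemma nonwandering_return (x : X) N : nbhs x N ->
  exists n : nat, (1 <= n)%N /\ exists2 a, N a & N (T n a).
Proof.
move=> nN; apply: contrapT => noret; apply: (nonwand (x := x)); exists N; split=> // n n1.
apply/seteqP; split=> // a [/= Na Nn]; apply: noret; exists n; split=> //; exists a => //.
Qed.

(** [U] consists of long return times near [y]. If nearby points return along [U] but [y] does not,
    boundaries around [y] contain points that the opposite of [U] sends to [y], and its fibre over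
    [y] is closed. *)
Lemma aperiodic_recurrent y : aperiodic y ->
  exists U, [/\ UltraFilter U, free_filter U & ulim U y = y].
Proof.
move=> ay; pose D (i : set X * nat) := nbhs y i.1.
pose B (i : set X * nat) := [set n : int | (i.2 <= `|n|)%N /\ exists2 a, i.1 a & i.1 (T n a)].
have [| | |U [UU UB]] := @ultra_base _ _ D B.
- by exists (setT, 0%N); exact: filterT.
- move=> [N k] [M l] /= nN nM; exists (N `&` M, maxn k l); first exact: filterI.
  move=> n [/=]; rewrite geq_max => /andP[kn ln] [a [Na Ma] [Nn Mn]].
  by split; split=> //; exists a.
- move=> [N k] /= nN; have [M nM HM] := aperiodic_separated_nbhs k ay.
  have [n [n1 [a [Na Ma] [Nn Mn]]]] := nonwandering_return (filterI nN nM).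
  exists n; split; last by exists a.
  rewrite leqNgt; apply/negP => nk; apply: (HM n _ nk a) => //; lia.
have fU : free_filter U.
  by move=> k; apply: filterS (UB (setT, k) (@filterT _ _ _)) => n [].
have [Uy|Uy] := pselect (ulim U y = y); first by exists U.
exists (opp_filter U); have fOU := opp_filter_free UU fU.
split=> //; first exact: ultra_opp_filter.
have [W0 nW0 UW0] := ulim_neq UU Uy.
apply: ulim_fiber_closed => // W nW.
have [V [oV Vy VW fV]] := regular_nbhs regX (filterI nW nW0).
have [|b bV bz] := @boundary_ulim U y V _ oV fV.
  move=> N nN; have nNV : nbhs y (N `&` V).
    by apply: filterI => //; exact: open_nbhs_nbhs.
  apply: filterS2 UW0 (UB (N `&` V, 0%N) nNV) => n /= W0n [_ [a [Na Va] [Nn Vn]]].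
  exists a, y; split=> //; first exact: nbhs_singleton nN.
  by move=> /(@subset_closure _ V)/VW[].
by exists b; split=> //; case: bV => /VW[].
Qed.

(** * Aperiodic points have aperiodic limits *)

Definition divisible_filter (U : set_system int) : Prop :=
  forall k : int, k != 0 -> U [set n | (k %| n)%Z].

Lemma divisible_filterN U : UltraFilter U -> divisible_filter U ->
  divisible_filter (opp_filter U).
Proof.
move=> UU dU k k0; rewrite /opp_filter /fmap /=; apply: filterS (dU k k0) => n /=.
by rewrite !dvdzE abszN.
Qed.

Lemma ulim_divisible_periodic U x : UltraFilter U -> divisible_filter U ->
  ~ aperiodic x -> ulim U x = x.
Proof.
move=> UU dU /aperiodicPn[m m0 mx]; apply: ulim_eq => W nW.
apply: filterS (dU m m0) => n /= /dvdzP[q ->]; rewrite (itz_mul_period fK gK) //.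
exact: nbhs_singleton nW.
Qed.

(** After removing the constant residue [j] of the times modulo a period [m] of the limit, they can
    be corrected by multiples of [m], which fix the limit, to become divisible by any [k]. *)
Lemma divisible_limit U y : UltraFilter U -> ~ aperiodic (ulim U y) ->
  exists r p, [/\ UltraFilter p, divisible_filter p & ulim p (T r y) = ulim U y].
Proof.
move=> UU; set x := ulim U y => /aperiodicPn[m m0 mx].
have [|j Uj] := @ultra_bounded_residue _ U (fun n => `|(n %% m)%Z|%N) `|m|%N UU.
  by apply: filterE => n /=; have := ltz_mod n m0; have := modz_ge0 n m0; lia.
exists j%:Z; pose D (i : set X * int) := nbhs x i.1 /\ i.2 != 0.
pose B (i : set X * int) := [set n : int | (i.2 %| n)%Z /\ i.1 (T n (T j y))].
have [| | |p [Up pB]] := @ultra_base _ _ D B.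
- by exists (setT, 1); split=> //; exact: filterT.
- move=> [V k] [W l] [/= nV k0] [/= nW l0]; exists (V `&` W, k * l).
    by split; [exact: filterI|rewrite mulf_neq0].
  move=> n [/= kln [Vn Wn]]; split; split=> //=.
    exact: dvdz_trans (dvdz_mulr _ (dvdzz k)) kln.
  exact: dvdz_trans (dvdz_mull _ (dvdzz l)) kln.
- move=> [V k] [/= nV k0].
  have nV' : nbhs x [set a | forall i : 'I_`|k|%N, V (T (i%:Z * m) a)].
    apply: filter_forall => i; apply: itz_nbhs.
    by rewrite (itz_mul_period fK gK).
  have [n [/= Vn nj]] := filter_ex (filterI (ulimP UU nV') Uj).
  (* This [i], below the absolute value of [k], makes [q + i] divisible by [k]. *)
  pose q := (n %/ m)%Z; pose i := `|((- q) %% k)%Z|%N.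
  have ik : (i < `|k|)%N.
    by rewrite /i; have := ltz_mod (- q) k0; have := modz_ge0 (- q) k0; lia.
  have iE : i%:Z = ((- q) %% k)%Z by rewrite /i gez0_abs // modz_ge0.
  have nE : n = q * m + j%:Z.
    by rewrite {1}(divz_eq n m) -nj gez0_abs // modz_ge0.
  exists ((q + i%:Z) * m); split=> /=.
    apply: dvdz_mulr; rewrite iE {1}[q](_ : q = - (- q)); last by rewrite opprK.
    rewrite {1}(divz_eq (- q) k) opprD addrNK; apply/dvdzP.
    by exists (- ((- q) %/ k)%Z); rewrite mulNr.
  have := Vn (Ordinal ik) => /=.
  by rewrite nE -[iter j f y]/(T j%:Z y) -!TD addrCA addrA -mulrDl.
exists p; split=> //.
  by move=> k k0; apply: filterS (pB (setT, k) (conj (@filterT _ _ _) k0)) => n [].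
apply: ulim_eq => W nW.
by apply: filterS (pB (W, 1) (conj nW isT)) => n [].
Qed.

(** Periodic points near [y] would be fixed along [p] while [y] moves to [x]. Boundaries around [x]
    then give points that the opposite of [p] sends to [y], so it sends [x] to [y] as well; but it
    fixes the periodic point [x]. *)
Lemma aperiodic_nbhs p y : UltraFilter p -> divisible_filter p -> aperiodic y ->
  ~ aperiodic (ulim p y) -> nbhs y [set w | aperiodic w].
Proof.
move=> Up dp ay; set x := ulim p y => px; apply: contrapT => nper.
have per N : nbhs y N -> exists2 w, N w & ~ aperiodic w.
  move=> nN; apply: contrapT => now; apply: nper; apply: filterS nN => w Nw.
  by apply: contrapT => pw; apply: now; exists w.
have yx n : T n y <> x by move=> ynx; apply: px; rewrite -ynx; exact: aperiodic_itz.
have fp : free_filter p := ulim_free Up yx.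
have UO := ultra_opp_filter Up; have dO := divisible_filterN Up dp.
suff xy : ulim (opp_filter p) x = y.
  by apply: (yx 0); rewrite -[RHS](ulim_divisible_periodic UO dO px).
apply: ulim_fiber_closed => //; first exact: opp_filter_free.
move=> W nW; have [A [B [nA nB AB]]] := disjoint_nbhs (nesym (yx 0)).
have [V [oV Vx VW fV]] := regular_nbhs regX (filterI nW nA).
have [|b bV bz] := @boundary_ulim p y V _ oV fV.
  move=> N nN; have [w [Nw Bw] /aperiodicPn[m m0 mw]] := per _ (filterI nN nB).
  apply: filterS2 (ulimP Up (open_nbhs_nbhs (conj oV Vx))) (dp m m0) => n /= Vn.
  move=> /dvdzP[q nE]; exists y, w; split=> //; first exact: nbhs_singleton nN.
  rewrite nE (itz_mul_period fK gK) // => /(@subset_closure _ V)/VW[_ Aw].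
  exact: AB Aw Bw.
by exists b; split=> //; case: bV => /VW[].
Qed.

(* In the situation [sg * s < 0] along [q], the orbit of [y] comes back to [K] in the direction
   [sg] with bounded gaps, hence stays in finitely many translates of [K]. *)
Lemma orbit_in_translates q y C (sg : int) : UltraFilter q -> free_filter q ->
  ulim q y = y -> (sg == 1) || (sg == -1) -> q [set s | sg * s < 0] ->
  (forall z, ulim q z = y -> nbhs z C) -> (forall z, closure C z -> aperiodic z) ->
  exists L, forall n, exists2 i : nat, (i <= L)%N & closure C (T (n - sg * i%:Z) y).
Proof.
move=> Uq fq qy /orP sg1 qsg YC Ca.
pose M := closure [set T n y | n in [set: int]].
have sgE : sg = 1 \/ sg = -1 by case: sg1 => /eqP; [left|right].
(* [U] will consist of times against [sg] that lead [y] to [z]. The opposite limit [z'] of [z] then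
   lies with [y] in the fibre of [ulim U] over [z], so [q] sends it to [y] and [C] is a
   neighbourhood of it. *)
have ret z : closure C z -> M z -> exists2 k : nat, (0 < k)%N & nbhs (T (sg * k%:Z) z) C.
  move=> Cz Mz; pose D (i : set X * nat) := nbhs z i.1.
  pose B (i : set X * nat) := [set n : int | (i.2%:Z <= - (sg * n)) /\ i.1 (T n y)].
  have [| | |U [UU UB]] := @ultra_base _ _ D B.
  - by exists (setT, 0%N); exact: filterT.
  - move=> [N k] [N' l] /= nN nN'; exists (N `&` N', maxn k l); first exact: filterI.
    by move=> n [/= kln [Nn N'n]]; split; split=> //=; lia.
  - move=> [N k] /= nN; have [V [oV Vz VN _]] := regular_nbhs regX nN.
    have [_ [[n _ <-] Vn]] := Mz _ (open_nbhs_nbhs (conj oV Vz)).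
    have nV : nbhs (ulim q y) (T n @^-1` V).
      by rewrite qy; apply: itz_nbhs; exact: open_nbhs_nbhs.
    have [s /= [[Vs sgs] ks]] :=
      filter_ex (filterI (filterI (ulimP Uq nV) qsg) (fq (k + `|n|)%N)).
    exists (n + s); split; last by rewrite TD; apply: VN; exact: subset_closure.
    by case: sgE sgs => ->; rewrite /= ?(mul1r, mulN1r); lia.
  have fU : free_filter U.
    move=> k; apply: filterS (UB (setT, k) (@filterT _ _ _)) => n [/= kn _].
    by case: sgE kn => ->; rewrite ?mul1r ?mulN1r; lia.
  have Uy : ulim U y = z.
    by apply: ulim_eq => N nN; apply: filterS (UB (N, 0%N) nN) => n [].
  have az := Ca z Cz; have := ulim_return (y := y) UU fU; rewrite Uy => /(_ az) Uz'.
  have qz' : ulim q (ulim (opp_filter U) z) = y.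
    rewrite (ulim_fiber_asymptotic UU Uq fq az Uy) //; exact: subset_closure.
  have [V [oV Vz' VC _]] := regular_nbhs regX (YC _ qz').
  have := ulimP (ultra_opp_filter UU) (open_nbhs_nbhs (conj oV Vz')).
  rewrite /opp_filter /fmap /= => UV.
  have [n [/= Vn [/= n0 _]]] := filter_ex (filterI UV (UB (setT, 1%N) (@filterT _ _ _))).
  have nE : sg * `|n|%N%:Z = - n.
    by case: sgE n0 => ->; rewrite ?mul1r ?mulN1r; lia.
  exists `|n|%N; first by case: sgE n0 => ->; rewrite ?mul1r ?mulN1r; lia.
  rewrite nE; apply: filterS (open_nbhs_nbhs (conj oV Vn)) => a Va.
  by apply: VC; exact: subset_closure.
have cKM : compact (closure C `&` M).
  apply: (subclosed_compact _ (compX regX)) => //.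
  by apply: closedI; exact: closed_closure.
have [L HL] : exists L, forall z, closure C z -> M z ->
    exists2 k : nat, (0 < k <= L)%N & closure C (T (sg * k%:Z) z).
  suff [L HL] : exists L, forall z, (closure C `&` M) z ->
      exists2 k : nat, (0 < k <= L)%N & closure C (T (sg * k%:Z) z).
    by exists L => z Cz Mz; exact: HL.
  apply: (compact_ind cKM (P := fun A => exists L, forall z, A z ->
      exists2 k : nat, (0 < k <= L)%N & closure C (T (sg * k%:Z) z))).
  - by exists 0%N.
  - by move=> A B AB [L HL]; exists L => z /AB; exact: HL.
  - move=> A B [L HL] [L' HL']; exists (maxn L L') => z [/HL|/HL'] [k kL Ck];
      by exists k => //; lia.
  - move=> z [Cz Mz]; have [k k0 Ck] := ret z Cz Mz.
    exists (T (sg * k%:Z) @^-1` C); first exact: itz_nbhs.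
    by exists k => w Cw; exists k; [rewrite k0 leqnn|exact: subset_closure].
have My n : M (T n y) by apply: subset_closure; exists n.
exists L => n.
(* Start in [C] at a recurrence time [s] far enough against [sg], then walk to [n] in steps of
   [sg]. *)
have [s /= [[Cs sgs] sn]] := filter_ex (filterI (filterI
  (ulimP (x := y) Uq (YC _ (etrans (congr1 _ qy) qy))) qsg) (fq `|n|%N)).
pose j := `|n - s|%N; have nE : n = s + sg * j%:Z.
  by rewrite /j; case: sgE sgs => ->; rewrite !(mul1r, mulN1r); lia.
rewrite {}nE; elim: j => [|j [i iL Ci]].
  by exists 0%N => //; rewrite mulr0 addr0 subr0; exact: subset_closure.
have [iL'|Li] := ltnP i L.
  exists i.+1 => //; rewrite (_ : s + _ - _ = s + sg * j%:Z - sg * i%:Z) //.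
  by case: sgE => ->; rewrite !(mul1r, mulN1r); lia.
(* The delay [i] equals [L] here; a return after [k <= L] steps keeps it within [L]. *)
have [k /andP[k0 kL] Ck] := HL _ Ci (My _).
exists (i.+1 - k)%N; first lia.
rewrite (_ : s + _ - _ = sg * k%:Z + (s + sg * j%:Z - sg * i%:Z)); first by rewrite TD.
by case: sgE => ->; rewrite !(mul1r, mulN1r); lia.
Qed.

(* Otherwise [y] is recurrent and its fibre has a neighbourhood [C] without periodic points, so
   the orbit of [y] stays away from the periodic point [ulim U y]. *)
Lemma aperiodic_ulim U y : UltraFilter U -> aperiodic y -> aperiodic (ulim U y).
Proof.
move=> UU ay0; set x := ulim U y; apply: contrapT => px.
have [r [p [Up dp py]]] := divisible_limit UU px; rewrite -/x in py.
have {ay0} ay : aperiodic (T r y) by exact: aperiodic_itz.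
set y1 := T r y in ay py.
have [q [Uq fq qy]] := aperiodic_recurrent ay.
have fp : free_filter p.
  apply: (@ulim_free p y1 Up) => n; rewrite py => nx; apply: px; rewrite -nx.
  exact: aperiodic_itz.
have YD z : ulim q z = y1 -> nbhs z [set w | aperiodic w].
  move=> qz; apply: (aperiodic_nbhs Up dp).
    by apply: (aperiodic_of_ulim Uq); rewrite qz.
  rewrite (ulim_fiber_asymptotic Uq Up fp ay qy) ?py //; exact: subset_closure.
have cY : closed [set z | ulim q z = y1].
  by move=> z; exact: ulim_fiber_closed.
have [C YC CD] := compact_normal (@metric_hausdorff _ X) (compX regX) cY YD.
have [sg sg1 qsg] : exists2 sg : int, (sg == 1) || (sg == -1) & q [set s | sg * s < 0].
  have [qs|qs] := in_ultra_setVsetC [set s : int | s < 0] Uq.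
    by exists 1 => //; apply: filterS qs => s /=; rewrite mul1r.
  exists (-1) => //; apply: filterS2 qs (fq 1%N) => s /=; rewrite mulN1r; lia.
have [L HL] := orbit_in_translates Uq fq qy sg1 qsg YC CD.
have [h hP] := choice (fun n => let: ex_intro2 i iL Ci := HL n in
  ex_intro (fun i => (i <= L)%N /\ closure C (T (n - sg * i%:Z) y1)) i (conj iL Ci)).
(* The delay [h n] is constant along [p], so orbit points in [closure C] converge to a translate of
   the periodic point [x]. *)
have [|j pj] := @ultra_bounded_residue _ p h L.+1 Up.
  by apply: filterE => n /=; rewrite ltnS; case: (hP n).
suff Cx : closure C (T (- (sg * j%:Z)) x).
  apply: px => m m0 mx; apply: (CD _ Cx m m0).
  by rewrite TC mx.
apply: closed_closure => W nW.
have := nW; rewrite -py -ulim_itz // => /(ulimP Up) pW.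
have [n [/= Wn hn]] := filter_ex (filterI pW pj).
exists (T (n - sg * j%:Z) y1); split; last by rewrite TD.
by rewrite -hn; case: (hP n).
Qed.

(** * Injectivity of the limit maps and equicontinuity *)

Lemma ulim_periodic_attained U w : UltraFilter U -> ~ aperiodic w ->
  U [set n | T n w = ulim U w].
Proof.
move=> UU /aperiodicPn[m m0 mw].
have [|j Uj] := @ultra_bounded_residue _ U (fun n => `|(n %% m)%Z|%N) `|m|%N UU.
  by apply: filterE => n /=; have := ltz_mod n m0; have := modz_ge0 n m0; lia.
have Tj : U [set n | T n w = T j%:Z w].
  apply: filterS Uj => n /= nj; rewrite (divz_eq n m) addrC TD.
  rewrite (itz_mul_period fK gK) // -[RHS]/(T j%:Z w) -nj.
  by rewrite gez0_abs // modz_ge0.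
suff -> : ulim U w = T j%:Z w by [].
by apply: ulim_eq => W /nbhs_singleton Wj; apply: filterS Tj => n /= ->.
Qed.

(** By [ulim_return] at aperiodic points; periodic points are fixed by [ulim (sub_filter U)]. *)
Lemma ulim_sub_fiber U w : UltraFilter U -> free_filter U ->
  ulim U (ulim (sub_filter U) w) = ulim U w.
Proof.
move=> UU fU; rewrite ulim_sub //.
have [aw|pw] := pselect (aperiodic w).
  by apply: ulim_return => //; exact: aperiodic_ulim.
congr (ulim U _); apply: ulim_eq => W /nbhs_singleton Ww.
rewrite /opp_filter /fmap /=; apply: filterS (ulim_periodic_attained UU pw) => n /= <-.
by rewrite TK.
Qed.

Lemma ulim_periodic_inj U a b : UltraFilter U -> ~ aperiodic a -> ulim U a = ulim U b -> a = b.
Proof.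
move=> UU pa ab.
have pb : ~ aperiodic b.
  move=> /(aperiodic_ulim UU); rewrite -ab => /(aperiodic_of_ulim UU); exact: pa.
have [n [/= na nb]] := filter_ex (filterI (ulim_periodic_attained UU pa)
  (ulim_periodic_attained UU pb)).
by apply: (Tinj (n := n)); rewrite na nb.
Qed.

(** Over a periodic point the fibre has at most one point. *)
Lemma closed_ulim_fiber U x : UltraFilter U -> free_filter U ->
  closed [set z | ulim U z = x].
Proof.
move=> UU fU z clz; have [ax|px] := pselect (aperiodic x).
  exact: ulim_fiber_closed clz.
have [b [/= bx _]] := clz setT (@filterT _ _ _).
have pb : ~ aperiodic b by move=> /(aperiodic_ulim UU); rewrite bx.
suff -> : z = b by [].
apply: contrapT => /disjoint_nbhs[A [B [nA /nbhs_singleton Bb AB]]].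
have [c [/= cx Ac]] := clz _ nA; apply: (AB c Ac).
by rewrite -(@ulim_periodic_inj U b c) // bx.
Qed.

(* The fibres of [ulim U] of diameter at least [e] are finitely many, and closed. *)
Lemma ulim_sub_close U z (e : R) : UltraFilter U -> free_filter U -> 0 < e ->
  exists2 N, nbhs z N & forall w, N w -> ulim U w <> ulim U z ->
    mdist w (ulim (sub_filter U) w) < e.
Proof.
move=> UU fU e0; have [F /finite_seqP[r ->] HF] := finite_separator e0.
have [N nN HN] : exists2 N, nbhs z N & forall b, b \in r -> ulim U b <> ulim U z ->
    forall w, N w -> ulim U w <> ulim U b.
  elim: r {HF} => [|b r [N nN HN]]; first by exists setT => //; exact: filterT.
  have [bz|bz] := pselect (ulim U b = ulim U z).
    by exists N => // c; rewrite inE => /orP[/eqP->|]; [rewrite bz|exact: HN].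
  exists (N `&` ~` [set w | ulim U w = ulim U b]).
    apply: filterI => //; apply: open_nbhs_nbhs; split; last exact: nesym.
    by apply: closed_openC; exact: closed_ulim_fiber.
  move=> c; rewrite inE => /orP[/eqP-> _ w []//|cr cz w [Nw _]].
  exact: HN Nw.
exists N => // w Nw wz; rewrite ltNge; apply/negP => ew.
have [|b br bw] := HF U _ _ UU ew; first by rewrite ulim_sub_fiber.
by apply: (HN b br _ w Nw); rewrite bw.
Qed.

(** A nearby point [w] of another fibre is hardly moved by [ulim (sub_filter U)] while [z] is moved
    away; boundaries around [z] thus contain points that the opposite ultrafilter sends to [z]. *)
Lemma ulim_sub_recurrent U z : UltraFilter U -> free_filter U -> aperiodic z ->
  ulim (sub_filter U) z <> z -> ulim (opp_filter (sub_filter U)) z = z.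
Proof.
move=> UU fU az ez; have UE := ultra_sub_filter UU; have fE := sub_filter_free UU fU.
have UO := ultra_opp_filter UE; apply: ulim_fiber_closed => //.
  exact: opp_filter_free.
move=> W nW; have [A [B [nA nB AB]]] := disjoint_nbhs (nesym ez).
have [V [oV Vz VW fV]] := regular_nbhs regX (filterI nW nA).
have [d d0 dV] := nbhs_mdist (open_nbhs_nbhs (conj oV Vz)).
have d2 : 0 < d / 2 by rewrite divr_gt0.
have [N1 nN1 HN1] := ulim_sub_close z UU fU d2.
have [|b bV bz] := @boundary_ulim (sub_filter U) z V _ oV fV; last first.
  by exists b; split=> //; case: bV => /VW[].
move=> N nN.
have nN' : nbhs z (N `&` N1 `&` [set y | mdist z y < d / 2]).
  by apply: filterI; [exact: filterI|exact: mdist_nbhs].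
have [w [[Nw N1w] zw] wz] : exists2 w, (N `&` N1 `&` [set y | mdist z y < d / 2]) w &
    ulim U w <> ulim U z.
  (* One of [a] and [T n a] lies in another fibre, because [T n] does not fix [ulim U z]. *)
  have [n [n1 [a Na Nna]]] := nonwandering_return nN'.
  have [za|] := pselect (ulim U a = ulim U z); last by exists a.
  exists (T n a) => //; rewrite ulim_itz // za; apply: (aperiodic_ulim UU az); lia.
have Vw : V (ulim (sub_filter U) w).
  apply: dV; apply: le_lt_trans (metric_triangle z w _) _; rewrite (splitr d).
  by apply: ltrD => //; exact: HN1.
apply: filterS2 (ulimP UE (open_nbhs_nbhs (conj oV Vw))) (ulimP UE nB) => n /= Vn Bn.
exists w, z; split=> //; first exact: nbhs_singleton nN.
by move=> /(@subset_closure _ V)/VW[_ /AB].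
Qed.

(* A non-trivial fibre over an aperiodic point has at least three points. All of them tend to the
   same point along [sub_filter U], and to the same point along its opposite; but the latter fixes
   every point of the fibre that the former moves. *)
Lemma ulim_inj U : UltraFilter U -> injective (ulim U).
Proof.
move=> UU a b ab; have [aa|pa] := pselect (aperiodic a); last exact: ulim_periodic_inj ab.
have ax := aperiodic_ulim UU aa.
have [fU|[n Un]] := free_or_principal UU; last first.
  by move: ab; rewrite !(ulim_principal _ UU Un) => /Tinj.
apply: contrapT => nab; have [A [B [nA nB AB]]] := disjoint_nbhs nab.
have [V [oV Va VA fV]] := regular_nbhs regX nA.
have [|c [cV nVc] cx] := ulim_fiber_boundary UU oV fV ab Va.
  by move=> /(@subset_closure _ V)/VA/AB; apply; exact: nbhs_singleton nB.
have nac : a <> c by move=> ac; apply: nVc; rewrite -ac (interior_id V).1.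
have nbc : b <> c by move=> bc; apply: (AB c (VA _ cV)); rewrite -bc; exact: nbhs_singleton nB.
have UE := ultra_sub_filter UU; have fE := sub_filter_free UU fU.
have UO := ultra_opp_filter UE; have fO := opp_filter_free UE fE.
pose S := [set z | ulim U z = ulim U a].
have [Sa Sb Sc] : [/\ S a, S b & S c] by [].
have sameE z : S z -> ulim (sub_filter U) z = ulim (sub_filter U) a.
  by move=> Sz; apply: (ulim_fiber_asymptotic UU UE fE ax) => //; exact: subset_closure.
have sameO z : S z -> ulim (opp_filter (sub_filter U)) z = ulim (opp_filter (sub_filter U)) a.
  by move=> Sz; apply: (ulim_fiber_asymptotic UU UO fO ax) => //; exact: subset_closure.
set w := ulim (sub_filter U) a in sameE.
have aS z : S z -> aperiodic z by move=> Sz; apply: (aperiodic_of_ulim UU); rewrite Sz.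
have moved z z' : S z -> S z' -> z <> w -> z' <> w -> z = z'.
  move=> Sz Sz' zw zw'.
  rewrite -(ulim_sub_recurrent UU fU (aS z Sz)); last by rewrite sameE //; exact: nesym.
  rewrite -[RHS](ulim_sub_recurrent UU fU (aS z' Sz')).
    by rewrite !sameO.
  by rewrite sameE //; exact: nesym.
have [aw|naw] := pselect (a = w).
  by apply: nbc; apply: moved => //; rewrite -aw; [exact: nesym|exact: nesym].
have [bw|nbw] := pselect (b = w); last by apply: nab; exact: moved.
by apply: nac; apply: moved => //; rewrite -bw; exact: nesym.
Qed.

(** If it fails, let [U] consist of times that spread small neighbourhoods of [z] by [e]. Small
    boundaries around [ulim U z] yield two distinct points with limit [z] along the opposite
    ultrafilter, against injectivity. *)
Lemma itz_equicontinuous z (e : R) : 0 < e ->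
  nbhs z [set a | forall n, mdist (T n z) (T n a) < e].
Proof.
move=> e0; apply: contrapT => neq.
pose B (N : set X) := [set n | exists2 a, N a & e <= mdist (T n z) (T n a)].
have [| | |U [UU UB]] := @ultra_base _ _ (nbhs z) B.
- by exists setT; exact: filterT.
- move=> N M nN nM; exists (N `&` M); first exact: filterI.
  by move=> n [a [Na Ma] ea]; split; exists a.
- move=> N nN; apply: contrapT => noB; apply: neq; apply: filterS nN => a Na n.
  by rewrite ltNge; apply/negP => ea; apply: noB; exists n, a.
have e2 : 0 < e / 2 by rewrite divr_gt0.
pose c := ulim U z.
have acc W : nbhs c W -> exists b, [/\ W b, b <> c & ulim (opp_filter U) b = z].
  move=> nW; have [V [oV Vc VW fV]] := regular_nbhs regX (filterI nW (mdist_nbhs c e2)).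
  have [|b [bV nVb] bz] := @boundary_ulim U z V _ oV fV.
    move=> N nN; apply: filterS2 (ulimP UU (open_nbhs_nbhs (conj oV Vc))) (UB N nN).
    move=> n /= Vn [a Na ea]; exists z, a; split=> //; first exact: nbhs_singleton nN.
    move=> Va; have [_ /= ca] := VW _ (subset_closure Va).
    have [_ /= cz] := VW _ (subset_closure Vn).
    move: ea; apply/negP; rewrite -ltNge; apply: le_lt_trans (metric_triangle _ c _) _.
    by rewrite (splitr e) (metric_sym _ c); apply: ltrD.
  exists b; split=> //; first by case: (VW _ bV).
  by move=> bc; apply: nVb; rewrite bc (interior_id V).1.
have [b [_ bc bz]] := acc setT (@filterT _ _ _).
have [A [D [nA /nbhs_singleton Db AD]]] := disjoint_nbhs (nesym bc).
have [b' [Ab' _ bz']] := acc A nA.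
by apply: (AD b' Ab'); rewrite (@ulim_inj _ (ultra_opp_filter UU) b' b) // bz'.
Qed.

End dynamics.

(** * Entropy of the induced map *)

Lemma limn_esup_ge (R : realType) (u : (\bar R)^nat) (l : \bar R) :
  (\forall n \near \oo, (l <= u n)%E) -> (l <= limn_esup u)%E.
Proof.
move=> lu; apply: le_ereal_inf_tmp => _ [A FA <-].
have [n [ln An]] := filter_ex (filterI lu FA).
by apply: le_trans ln _; apply: ereal_sup_ubound; exists n.
Qed.

(** * Equicontinuity gives entropy zero *)

Section hyperspace_dynamics.
Context {R : realType} {X : metricType R}.
Implicit Types (A B : hyperspace X).

Lemma hausdorff_dist_le A B (r : R) :
  (forall a, hyperset A a -> exists2 b, hyperset B b & mdist a b <= r) ->
  (forall b, hyperset B b -> exists2 a, hyperset A a & mdist b a <= r) ->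
  mdist A B <= r.
Proof.
move=> AB BA; rewrite [mdist A B]/(hausdorff_dist A B) /hausdorff_dist ge_max.
apply/andP; split; apply: excess_le => x.
  by move=> /AB[y By]; apply: le_trans; exact: infdist_le.
by move=> /BA[y Ay]; apply: le_trans; exact: infdist_le.
Qed.

Lemma hausdorff_dist_ge A B (r : R) a : hyperset A a ->
  (forall b, hyperset B b -> r <= mdist a b) -> r <= mdist A B.
Proof.
move=> Aa aB; rewrite [mdist A B]/(hausdorff_dist A B) /hausdorff_dist le_max.
by rewrite (le_trans (le_infdist aB) (infdist_le_excess B Aa)).
Qed.

Variable f : X -> X.
Hypothesis cf : continuous f.

Lemma iter_hypermap n A : hyperset (iter n (hypermap cf) A) = iter n f @` A.
Proof.
elim: n => [|n IH] /=; first by rewrite image_id.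
by rewrite IH image_comp.
Qed.

Local Notation F := (hypermap cf).

Lemma bowen_dist_ge n i A B (r : R) : (i < n)%N ->
  r <= mdist (iter i F A) (iter i F B) -> r <= bowen_dist F n A B.
Proof.
move=> i_n ri; apply: le_trans ri _.
exact: (le_bigmax 0 (fun j : 'I_n => mdist (iter j F A) (iter j F B)) (Ordinal i_n)).
Qed.

Lemma max_separated_ge n (e : R) (s : seq (hyperspace X)) :
  uniq s -> Defs.separated F n e s -> ((size s)%:R%:E <= max_separated F n e)%E.
Proof. by move=> us ss; apply: ereal_sup_ubound; exists s. Qed.

Lemma max_separated_ge1 n (e : R) A : (1 <= max_separated F n e)%E.
Proof.
apply: (@max_separated_ge n e [:: A]) => // B C; rewrite !mem_seq1 => /eqP BA /eqP CA.
by rewrite BA CA eqxx.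
Qed.

Hypothesis compX : compact [set: X].
Hypothesis neX : [set: X] !=set0.
Hypothesis equif : forall z (e : R), 0 < e ->
  nbhs z [set a | forall n, mdist (iter n f z) (iter n f a) < e].

Lemma equicontinuous_partition (e : R) : 0 < e ->
  exists (k : nat) (c : X -> nat), (forall a, (c a < k)%N) /\
    forall a b, c a = c b -> forall n, mdist (iter n f a) (iter n f b) < e.
Proof.
move=> e0; pose P (A : set X) := exists (k : nat) (c : X -> nat),
  (forall a, A a -> (c a < k)%N) /\
  forall a b, A a -> A b -> c a = c b -> forall n, mdist (iter n f a) (iter n f b) < e.
suff [k [c [ck cc]]] : P setT.
  by exists k, c; split=> [a|a b]; [exact: ck|exact: cc].
apply: (compact_ind compX).
- by exists 0%N, (fun=> 0%N).
- move=> A B AB [k [c [ck cc]]]; exists k, c; split=> [a /AB|a b /AB Ba /AB Bb].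
    exact: ck.
  exact: cc.
- move=> A B [k [c [ck cc]]] [l [d [dl dd]]].
  (* Shifting by [k] keeps the labels of the two partitions apart. *)
  exists (k + l)%N, (fun x => if `[< A x >] then c x else (k + d x)%N); split.
    move=> a [Aa|Ba]; case: asboolP => nA //; try by have := ck a ltac:(done); lia.
    by have := dl a Ba; lia.
  move=> a b ABa ABb; case: asboolP => Aa; case: asboolP => Ab.
  + exact: cc.
  + by have := ck a Aa; lia.
  + by have := ck b Ab; lia.
  + by move=> /addnI; apply: dd; [case: ABa|case: ABb].
- move=> z _; have e2 : 0 < e / 2 by rewrite divr_gt0.
  exists [set a | forall n, mdist (iter n f z) (iter n f a) < e / 2]; first exact: equif.
  exists 1%N, (fun=> 0%N); split=> // a b za zb _ n.
  apply: le_lt_trans (metric_triangle _ (iter n f z) _) _; rewrite (splitr e).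
  by apply: ltrD => //; rewrite metric_sym.
Qed.

(* A compact set is determined, up to [e] and at all times, by the pieces of a finite partition
   that it meets. *)
Lemma separated_bounded (e : R) : 0 < e ->
  exists M : nat, forall n s, uniq s -> Defs.separated F n e s -> (size s <= M)%N.
Proof.
move=> e0; have [k [c [ck cc]]] := equicontinuous_partition e0.
pose code (A : hyperspace X) := [set i : 'I_k | `[< exists2 a, hyperset A a & c a = i >]]%SET.
exists #|{set 'I_k}| => n s us ss.
have code_inj : {in s &, injective code}.
  move=> A B As Bs AB; apply/eqP; apply/negP => /negP nAB.
  have := ss A B As Bs nAB; apply/negP; rewrite -leNgt.
  have half A' B' : code A' = code B' -> forall j a, hyperset (iter j F A') a ->
      exists2 b, hyperset (iter j F B') b & mdist a b <= e.
    move=> AB' j a; rewrite !iter_hypermap => -[x Ax <-].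
    have : Ordinal (ck x) \in code A' by rewrite inE; apply/asboolP; exists x.
    rewrite AB' inE => /asboolP[y By /= yx].
    exists (iter j f y); first by exists y.
    by apply/ltW; apply: cc.
  apply: bigmax_le => [|j _]; first exact: ltW.
  by apply: hausdorff_dist_le; apply: half.
by rewrite -(size_map code) -(card_uniqP _) ?max_card // map_inj_in_uniq.
Qed.

(** The separation numbers lie between [1], by the singleton [A], and an [M] independent of [n]. *)
Lemma hypermap_entropy_at0 (e : R) : 0 < e -> entropy_at F e = 0%E.
Proof.
move=> e0; have [M HM] := separated_bounded e0.
have [x _] := neX; pose A := Hyperspace (ex_intro _ x erefl) (@compact_set1 _ x).
have M1 : (0 < M)%N.
  apply: (HM 0%N [:: A]) => // B C; rewrite !mem_seq1 => /eqP BA /eqP CA.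
  by rewrite BA CA eqxx.
have MR : (0 < M%:R :> R) by rewrite ltr0n.
have S1 n := max_separated_ge1 n e A.
have SM n : (max_separated F n e <= M%:R%:E)%E.
  apply: ge_ereal_sup => _ [s [us ss] <-]; rewrite lee_fin ler_nat; exact: HM ss.
have cvM : (n%:R^-1%:E * (ln M%:R)%:E : \bar R)%E @[n --> \oo] --> 0%E.
  rewrite -cvg_shiftS /=.
  under eq_fun do rewrite -EFinM.
  apply: cvg_EFin; first by apply: nearW.
  rewrite -[0](mul0r (ln (M%:R : R))); apply: cvgMl.
  exact: cvg_harmonic.
rewrite /entropy_at.
apply: (cvg_limn_einf_sup _).2.
apply: squeeze_cvge (cvg_cst 0%E) cvM.
near=> n; apply/andP; split.
  by rewrite mule_ge0 ?lee_fin ?invr_ge0 ?ler0n // lne_ge0.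
apply: lee_wpmul2l; first by rewrite lee_fin invr_ge0 ler0n.
rewrite -lne_EFin // lee_lne ?SM // in_itv /= leey andbT; last first.
  by rewrite lee_fin ler0n.
exact: le_trans (S1 n).
Unshelve. all: by end_near.
Qed.

Lemma hypermap_entropy0 : topological_entropy F = 0%E.
Proof.
apply: lim_near_cst; first exact: ereal_hausdorff.
near=> e; apply: hypermap_entropy_at0.
by near: e; exact: nbhs_right_gt.
Unshelve. all: by end_near.
Qed.

End hyperspace_dynamics.

(** * A wandering point gives infinite entropy *)

Section wandering_point.
Context {R : realType} {X : metricType R}.
Variables f g : X -> X.
Hypotheses (fK : cancel f g) (gK : cancel g f) (cf : continuous f).
Hypothesis connX : connected [set: X].

Local Notation T := (itz f g).
Local Notation F := (hypermap cf).

Lemma wandering_itz (U : set X) :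
  (forall n : nat, (1 <= n)%N -> (iter n f @^-1` U) `&` U = set0) ->
  forall n a, n != 0 -> U a -> ~ U (T n a).
Proof.
move=> wU; have pos n a : (0 < n)%N -> U a -> ~ U (T n%:Z a).
  by move=> n0 Ua Un; have := wU n n0; apply/eqP/set0P; exists a.
case=> n a n0 Ua Un; first by apply: pos Un => //; lia.
apply: (pos n.+1 (T (Negz n) a)) => //.
by rewrite NegzE (itzNK fK gK).
Qed.

(** Otherwise the open ball of radius [r] equals the closed one and is all of [X] by
    connectedness. *)
Lemma sphere_neq0 (x z : X) (r : R) : 0 < r -> r <= mdist x z ->
  exists y, mdist x y = r.
Proof.
move=> r0 rz; apply: contrapT => nor.
suff ball_setT : [set y | mdist x y < r] = setT.
  have : [set y | mdist x y < r] z by rewrite ball_setT.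
  by rewrite /= ltNge rz.
apply: connX; first by exists x; rewrite /= mdistxx.
  exists [set y | mdist x y < r]; last by rewrite setTI.
  rewrite openE => y /= xy; rewrite -subr_gt0 in xy.
  apply: filterS (mdist_nbhs y xy) => w /=; rewrite ltrBrDl; apply: le_lt_trans.
  exact: metric_triangle.
exists [set y | mdist x y <= r]; first exact: mdist_closed_ball.
rewrite setTI; apply/seteqP; split=> y /=; first exact: ltW.
by rewrite le_eqVlt => /orP[/eqP xy|//]; exfalso; apply: nor; exists y.
Qed.

Section coding.
Variables (x : X) (U : set X) (e : R) (k : nat) (y : 'I_k -> X).
Hypothesis e0 : 0 < e.
Hypothesis ballU : forall z, mdist x z < e -> U z.
Hypothesis wU : forall n : nat, (1 <= n)%N -> (iter n f @^-1` U) `&` U = set0.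
(** The points [y i] lie on spheres of radii [d] to [k * d = e - d] about [x]: at least [d] from
    each other and from all points outside the ball of radius [e]. *)
Local Notation d := (e / k.+1%:R).
Hypothesis dy : forall i, mdist x (y i) = i.+1%:R * d.

(* The set whose image at time [j] meets the wandering neighbourhood [U] exactly in
   [y (w j)]. *)
Definition coded_set n (w : {ffun 'I_n.+1 -> 'I_k}) : hyperspace X :=
  @Hyperspace R X [set T (- (j%:Z)) (y (w j)) | j in [set: 'I_n.+1]]
    (image_nonempty _ (ex_intro _ ord0 I))
    (finite_compact (finite_image _ (@finite_finset _ [set: 'I_n.+1]))).

(** At time [j] the first set contains [y (w j)]. A point of the second is [y (w' j)], on another
    sphere, or comes from some [j' != j] and lies outside [U], at distance at least [e] from [x]. *)
Lemma coded_set_far n (w w' : {ffun 'I_n.+1 -> 'I_k}) (j : 'I_n.+1) : w j != w' j ->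
  d <= mdist (iter j F (coded_set w)) (iter j F (coded_set w')).
Proof.
move=> ww'; have d0 : 0 < d by rewrite divr_gt0 // ltr0n.
have dk i : mdist x (y i) <= e - d.
  have {1}-> : e = k.+1%:R * d by rewrite mulrC divfK ?pnatr_eq0.
  rewrite -natr1 mulrDl mul1r addrK natr1.
  by rewrite dy ler_wpM2r ?ler_nat // ltW.
have Uy i : U (y i) by apply: ballU; apply: le_lt_trans (dk i) _; rewrite ltrBlDr ltrDl.
apply: (hausdorff_dist_ge (a := y (w j))).
  rewrite iter_hypermap; exists (T (- j%:Z) (y (w j))); first by exists j.
  by rewrite -[iter j f]/(T j%:Z) (itzNK fK gK).
move=> b; rewrite iter_hypermap => -[_ [j' _ <-] <-].
rewrite -[iter j f]/(T j%:Z) -(itzD fK gK).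
have [<-|jj'] := eqVneq j j'.
  rewrite subrr /=; have : (w j : nat) <> w' j by move=> /ord_inj/eqP; exact/negP.
  have tri1 := metric_triangle x (y (w j)) (y (w' j)).
  have tri2 := metric_triangle x (y (w' j)) (y (w j)).
  move: tri1 tri2; rewrite (metric_sym (y (w' j))) !dy => tri1 tri2.
  move=> /eqP; rewrite neq_ltn => /orP[|] lt.
    apply: (@le_trans _ _ ((w' j).+1%:R * d - (w j).+1%:R * d)); last by rewrite lerBlDl.
    by rewrite -mulrBl ler_peMl ?(ltW d0) // -natrB ?ler1n; lia.
  apply: (@le_trans _ _ ((w j).+1%:R * d - (w' j).+1%:R * d)); last by rewrite lerBlDl.
  by rewrite -mulrBl ler_peMl ?(ltW d0) // -natrB ?ler1n; lia.
have far : e <= mdist x (T (j%:Z - j'%:Z) (y (w' j'))).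
  rewrite leNgt; apply/negP => /ballU; apply: (wandering_itz wU) => //.
  by apply/negP => /eqP jE; move/eqP: jj'; apply; apply: ord_inj; lia.
rewrite -(lerD2l (mdist x (y (w j)))); apply: le_trans (metric_triangle _ _ _).
by apply: le_trans far; rewrite -lerBrDr.
Qed.

Lemma coded_max_separated n (eps : R) : 0 < eps -> eps < d ->
  ((k ^ n.+1)%:R%:E <= max_separated F n.+1 eps)%E.
Proof.
move=> eps0 epsd.
have far (w w' : {ffun 'I_n.+1 -> 'I_k}) : w != w' ->
    eps < bowen_dist F n.+1 (coded_set w) (coded_set w').
  move=> ww'; have [j jw] : exists j, w j != w' j.
    apply: contrapT => now; move/eqP: ww'; apply; apply/ffunP => j.
    by apply/eqP/negPn/negP => jw; apply: now; exists j.
  by apply: lt_le_trans epsd _; exact: bowen_dist_ge (ltn_ord j) (coded_set_far jw).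
have bxx (w : {ffun 'I_n.+1 -> 'I_k}) : bowen_dist F n.+1 (coded_set w) (coded_set w) <= 0.
  by apply: bigmax_le => // i _; rewrite mdistxx.
have inj : injective (@coded_set n).
  move=> w w' ww'; apply/eqP/negPn/negP => /far; apply/negP; rewrite -leNgt ww'.
  exact: le_trans (bxx _) (ltW eps0).
have -> : (k ^ n.+1)%N = size (map (@coded_set n) (enum {ffun 'I_n.+1 -> 'I_k})).
  by rewrite size_map -cardE card_ffun !card_ord.
apply: max_separated_ge; first by rewrite map_inj_uniq // enum_uniq.
move=> _ _ /mapP[w _ ->] /mapP[w' _ ->] ww'; apply: far.
by apply/eqP => E; move/eqP: ww'; rewrite E.
Qed.

End coding.

Lemma wandering_entropy_at x : wandering f x -> exists2 e : R, 0 < e &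
  forall (k : nat) (eps : R), 0 < eps -> eps < e / k.+2%:R ->
    ((ln k.+1%:R)%:E <= entropy_at F eps)%E.
Proof.
move=> [U [nU wU]]; have [e e0 ballU] := nbhs_mdist nU.
exists e => // k eps eps0 epse; have d0 : 0 < e / k.+2%:R by rewrite divr_gt0 // ltr0n.
(* [f x] lies outside [U], so [X] has points at every positive distance up to [e] from [x]. *)
have efx : e <= mdist x (f x).
  rewrite leNgt; apply/negP => /ballU; apply: (wandering_itz wU (n := 1)) => //.
  exact: nbhs_singleton nU.
have /choice[y dy] : forall i : 'I_k.+1, exists z, mdist x z = i.+1%:R * (e / k.+2%:R).
  move=> i; apply: (@sphere_neq0 x (f x)).
    by rewrite mulr_gt0 // ltr0n.
  apply: le_trans efx; rewrite mulrCA ger_pMr // ler_pdivrMr ?ltr0n // mul1r ler_nat.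
  by have := ltn_ord i; lia.
apply: limn_esup_ge; near=> n.
have n0 : (0 < n)%N by near: n; exists 1%N.
rewrite -(prednK n0).
have S := coded_max_separated e0 ballU wU dy n.-1 eps0 epse.
have k0 : (0 : R) < (k.+1 ^ n.-1.+1)%:R by rewrite ltr0n expn_gt0.
apply: (@le_trans _ _ ((n.-1.+1%:R)^-1%:E * lne (k.+1 ^ n.-1.+1)%:R%:E)%E).
  by rewrite lne_EFin // -EFinM lee_fin natrX lnXn ?ltr0n // -(mulr_natl (ln _)) mulKf //.
apply: lee_wpmul2l; first by rewrite lee_fin invr_ge0 ler0n.
rewrite lee_lne // in_itv /= leey andbT; first by rewrite lee_fin ltW.
by apply: le_trans S; rewrite lee_fin ltW.
Unshelve. all: by end_near.
Qed.

Lemma wandering_entropy x : wandering f x -> topological_entropy F = +oo%E.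
Proof.
move=> /wandering_entropy_at[e e0 He]; apply: cvg_lim; first exact: ereal_hausdorff.
(* [k] exceeds [expR M], so the bound [ln k.+1], valid for all small [eps], is at least [M]. *)
apply/cvgeyPge => M; pose k := Num.bound (expR M).
have kM : M <= ln (k.+1%:R : R).
  rewrite -[M]expRK ler_ln ?posrE ?expR_gt0 ?ltr0n //.
  apply/ltW; apply: lt_trans (archi_boundP (expR_ge0 M)) _.
  by rewrite ltr_nat.
near=> eps; apply: (@le_trans _ _ (ln (k.+1%:R : R))%:E); first by rewrite lee_fin.
apply: He; near: eps; first exact: nbhs_right_gt.
by apply: nbhs_right_lt; rewrite divr_gt0 // ltr0n.
Unshelve. all: by end_near.
Qed.

End wandering_point.

Local Open Scope ereal_scope.

Theorem corollary3p4 (R : realType) (X : metricType R) (f : X -> X)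
    (regX : regular_curve X) (homeo_f : homeomorphism f) :
  let h := topological_entropy (hypermap (homeomorphism_continuous homeo_f)) in
  [/\ ~` nonwandering_set f !=set0 -> h = +oo,
      ~ (~` nonwandering_set f !=set0) -> h = 0
    & h = 0 \/ h = +oo].
Proof.
move=> h; have [cf [g [fK gK cg]]] := homeo_f.
have [[neX cX coX] _] := regX.
have hoo : ~` nonwandering_set f !=set0 -> h = +oo.
  by move=> [x /contrapT wx]; exact: wandering_entropy fK gK _ coX _ wx.
have h0 : ~ (~` nonwandering_set f !=set0) -> h = 0.
  move=> nw; have nwf x : ~ wandering f x.
    by move=> wx; apply: nw; exists x; exact.
  apply: hypermap_entropy0 => // z e e0.
  apply: filterS (itz_equicontinuous regX fK gK cf cg nwf z e0) => a za n.
  exact: za n%:Z.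
split=> //; have [/hoo|/h0] := pselect (~` nonwandering_set f !=set0); first by right.
by left.
Qed.
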